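(* Let $\Phi$ be a balanced relative simplicial complex of dimension $d-1$ and let a finite group $\mathfrak G$ act on $\Phi$. Suppose $\Phi$ satisfies condition $(S_\ell)$. Then for all $S\subseteq T\subseteq[d]$ with $|S|\le\ell$, \[\sum_{R:\,S\subseteq R\subseteq T} h_R(\Phi,\mathfrak G)\ \ge_{\mathfrak G}\ 0.\] In particular, if $\Phi$ is relatively Cohen–Macaulay, then $h_T(\Phi,\mathfrak G)\ge_{\mathfrak G}0$ for all $T\subseteq[d]$.
   Context: A balanced relative simplicial complex of dimension $d-1$ on a finite vertex set $V$ is a nonempty collection $\Phi$ of subsets of $V$ together with $\kappa:V\to[d]$ such that: (i) $\rho\subseteq\sigma\subseteq\tau$, $\rho,\tau\in\Phi$ implies $\sigma\in\Phi$; (ii) every face lies in a face of size $d$; (iii) $\kappa$ is injective on every face. Write $\kappa(\sigma)=\{\kappa(v):v\in\sigma\}$. A finite group $\mathfrak G$ acts on $\Phi$ if it acts on $V$ with $\kappa(\mathfrak gv)=\kappa(v)$ and $\mathfrak g\sigma\in\Phi$ for all $\sigma\in\Phi$, $\mathfrak g\in\mathfrak G$. The equivariant flag $f$-vector: $f_S(\Phi,\mathfrak G)$ is the permutation character of $\mathfrak G$ on $\{\sigma\in\Phi:\kappa(\sigma)=S\}$; the equivariant flag $h$-vector is $h_S(\Phi,\mathfrak G)=\sum_{T\subseteq S}(-1)^{|S\setminus T|}f_T(\Phi,\mathfrak G)$ (equivalently, the coefficient of the fundamental quasisymmetric function $F_{S,d+1}$ in $\sum_S f_S(\Phi,\mathfrak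 G)M_{S,d+1}$). For class functions, $\chi\ge_{\mathfrak G}0$ means $\chi$ is an effective character (a nonnegative integer combination of irreducible characters), and $\chi\le_{\mathfrak G}\psi$ means $\psi-\chi\ge_{\mathfrak G}0$. Homology: the reduced chain complex of a collection $\Psi$ satisfying (i) has in degree $i$ the basis of faces of cardinality $i+1$, with the simplicial boundary omitting faces not in $\Psi$ (equivalently relative homology of $(\Delta,\Gamma)$ with $\Psi=\Delta\setminus\Gamma$); $\dim\Psi=\max\{|\tau|-1\}$; $\mathrm{lk}_\Psi(\sigma)=\{\tau\subseteq V\setminus\sigma:\tau\cup\sigma\in\Psi\}$. $\Phi$ satisfies $(S_\ell)$ if $\widetilde H_{i-1}(\mathrm{lk}_\Phi(\sigma))=0$ for every $\sigma$ contained in a face of $\Phi$ and every integer $i\le\min(\dim\mathrm{lk}_\Phi(\sigma),\ell-1)$; $\Phi$ is relatively Cohen–Macaulay if it satisfies $(S_{d})$ (i.e. $(S_{\dim\Phi+1})$). *)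

(* Defs.v *)
From HB Require Import structures.
From mathcomp Require Import all_boot all_order all_algebra.
From mathcomp Require Import all_fingroup all_solvable all_field all_character.

Set Implicit Arguments.
Unset Strict Implicit.
Unset Printing Implicit Defensive.

Import Order.TTheory GRing.Theory Num.Theory.
Local Open Scope ring_scope.

(* The color set [d] = {1, ..., d} is represented by 'I_d = {0, ..., d - 1}. *)
Record balancedRelComplex (V : finType) (d : nat) := BalancedRelComplex {
  faces :> {set {set V}};
  color : V -> 'I_d;
  faces_neq0 : faces != set0;
  faces_convex : forall rho sigma tau : {set V},
    rho \subset sigma -> sigma \subset tau ->
    rho \in faces -> tau \in faces -> sigma \in faces;
  faces_pure : forall sigma : {set V}, sigma \in faces ->
    exists tau : {set V}, [/\ tau \in faces, sigma \subset tau & #|tau| = d];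
  faces_balanced : forall sigma : {set V}, sigma \in faces ->
    {in sigma &, injective color}
}.

Section Homology.

(* F is the field of coefficients. *)
Variables (F : fieldType) (V : finType).
Implicit Types (Psi : {set {set V}}) (sigma tau : {set V}) (j : int).

Definition dim_collection Psi : int := (\max_(tau in Psi) #|tau|)%N%:Z - 1.

Definition link Psi sigma : {set {set V}} :=
  [set tau : {set V} | (tau \subset ~: sigma) && (tau :|: sigma \in Psi)].

(* The F-vector space with one coordinate for each subset of V; chains are
   the vectors in the span of the faces of Psi of the relevant dimension. *)
Definition chain_vec : vectType F := {ffun {set V} -> F^o}.

Definition face_vec sigma : chain_vec := [ffun tau => (tau == sigma)%:R].

Definition chains Psi j : {vspace chain_vec} :=
  <<[seq face_vec sigma | sigma <- enum Psi & (#|sigma|%:Z == j + 1)%R]>>%VS.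

(* Faces are oriented by the enumeration order of V. *)
Definition vertex_pos sigma (v : V) : nat :=
  #|[set w in sigma | (enum_rank w < enum_rank v)%N]|.

Definition boundary_fun Psi (c : chain_vec) : chain_vec :=
  \sum_(sigma in Psi) \sum_(v in sigma | sigma :\ v \in Psi)
    (c sigma * (-1) ^+ vertex_pos sigma v) *: face_vec (sigma :\ v).

Fact boundary_fun_is_linear Psi : linear (boundary_fun Psi).
Proof.
move=> a b c; rewrite /boundary_fun scaler_sumr -big_split /=.
apply: eq_bigr => sigma _; rewrite scaler_sumr -big_split /=.
apply: eq_bigr => v _.
by rewrite scalerA -scalerDl !ffunE mulrDl mulrA.
Qed.

HB.instance Definition _ Psi :=
  GRing.isLinear.Build F chain_vec chain_vec _ (boundary_fun Psi)
    (boundary_fun_is_linear Psi).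

Definition boundary Psi : 'End(chain_vec) := linfun (boundary_fun Psi).

Definition cycles Psi j : {vspace chain_vec} :=
  (chains Psi j :&: lker (boundary Psi))%VS.

Definition boundaries Psi j : {vspace chain_vec} :=
  (boundary Psi @: chains Psi (j + 1))%VS.

(* The j-th reduced homology cycles Psi j / boundaries Psi j is zero. *)
Definition homology_vanishes Psi j : Prop := (cycles Psi j <= boundaries Psi j)%VS.

Definition serre_condition Psi (l : nat) : Prop :=
  forall sigma tau : {set V}, tau \in Psi -> sigma \subset tau ->
  forall i : int, i <= Num.min (dim_collection (link Psi sigma)) (l%:Z - 1) ->
  homology_vanishes (link Psi sigma) (i - 1).

End Homology.

Definition relatively_CM (F : fieldType) (V : finType) (d : nat)
    (Phi : balancedRelComplex V d) : Prop :=
  serre_condition F Phi d.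

(* Group actions are right actions here; a left action g v gives the right
   action v |-> g^-1 v, which has the same permutation characters, since g and
   g^-1 fix the same faces. *)
Record complexAction (V : finType) (d : nat) (Phi : balancedRelComplex V d)
    (gT : finGroupType) (G : {group gT}) := ComplexAction {
  vertex_act :> action G V;
  act_color : forall (g : gT) (v : V), g \in G ->
    color Phi (vertex_act v g) = color Phi v;
  act_faces : forall (g : gT) (sigma : {set V}), g \in G -> sigma \in Phi ->
    [set vertex_act v g | v in sigma] \in Phi
}.

Section FlagVectors.

Variables (V : finType) (d : nat) (Phi : balancedRelComplex V d).
Variables (gT : finGroupType) (G : {group gT}) (act : complexAction Phi G).
Implicit Types (S T : {set 'I_d}) (g : gT).

Definition colored_faces S : {set {set V}} :=
  [set sigma in Phi | color Phi @: sigma == S].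

Definition fixed_faces S g : {set {set V}} :=
  [set sigma in colored_faces S | [set act v g | v in sigma] == sigma].

Lemma act_imset_comp (sigma : {set V}) g h : g \in G -> h \in G ->
  [set act v (g * h)%g | v in sigma] = [set act w h | w in [set act v g | v in sigma]].
Proof.
move=> Gg Gh; rewrite -imset_comp; apply: eq_imset => v /=.
by rewrite actMin.
Qed.

Lemma act_imset_inj g : injective (fun sigma : {set V} => [set act v g | v in sigma]).
Proof. exact: imset_inj (act_inj act g). Qed.

Lemma colored_faces_act S g sigma : g \in G -> sigma \in colored_faces S ->
  [set act v g | v in sigma] \in colored_faces S.
Proof.
move=> Gg; rewrite !inE => /andP[Ps /eqP <-]; rewrite act_faces //=.
by rewrite -imset_comp; apply/eqP/eq_imset => v /=; rewrite act_color.
Qed.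

Lemma fixed_faces_conj_le S g h : g \in G -> h \in G ->
  (#|fixed_faces S g| <= #|fixed_faces S (g ^ h)%g|)%N.
Proof.
move=> Gg Gh; rewrite -(card_imset _ (@act_imset_inj h)); apply: subset_leq_card.
apply/subsetP => _ /imsetP[sigma + ->]; rewrite inE => /andP[Xs /eqP fixs].
rewrite inE colored_faces_act //= -act_imset_comp ?groupJ //.
by rewrite -conjgC act_imset_comp // fixs.
Qed.

Lemma fixed_faces_conj S g h : g \in G -> h \in G ->
  #|fixed_faces S (g ^ h)%g| = #|fixed_faces S g|.
Proof.
move=> Gg Gh; apply/eqP; rewrite eqn_leq fixed_faces_conj_le // andbT.
by rewrite -{2}(conjgK h g) fixed_faces_conj_le ?groupJ ?groupV.
Qed.

Fact flag_f_subproof S :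
  is_class_fun <<G>>%g
    [ffun g : gT => if g \in G then #|fixed_faces S g|%:R else 0].
Proof.
rewrite genGid; apply: intro_class_fun => [g h Gg Gh | g /negbTE-> //].
by rewrite groupJ // Gg fixed_faces_conj.
Qed.

(* The value at g of a permutation character is the number of fixed points
   of g; elements of 'CF(G) vanish outside G. *)
Definition flag_f S : 'CF(G) := Cfun 0 (flag_f_subproof S).

Definition flag_h S : 'CF(G) :=
  \sum_(T : {set 'I_d} | T \subset S) (-1) ^+ #|S :\: T| *: flag_f T.

End FlagVectors.

Definition effective (gT : finGroupType) (G : {group gT}) (chi : 'CF(G)) : Prop :=
  chi \is a character.

(* Main.v *)
Require Import Defs.
From mathcomp Require Import all_boot all_order all_algebra zify.
From mathcomp Require Import all_fingroup all_solvable all_field all_character.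

(* The alternating sum over [S <= R <= T] telescopes to the sum of
   (-1)^|T \ Q| f_Q over T \ S <= Q <= T, the equivariant Euler characteristic of
   the complex spanned by the faces whose color set lies between T \ S and T, where
   the differential deletes vertices with colors in S. Ordering vertices by color
   makes this differential equivariant without signs. If the complex is exact below
   its top degree |T|, the sum is the character of the space of top cycles.
   For T = [d] the complex is the direct sum of the link complexes of the faces with
   color set [d] \ S, so exactness is the hypothesis; in general one adds the missing
   colors one at a time: for c outside T, the complex of the interval
   [T \ S, T] is a subcomplex of that of [T \ S, T + c], with quotient that of
   [(T \ S) + c, T + c]. Since characters live in characteristic zero while the
   homology has coefficients in an arbitrary field F, exactness is first transferred
   from F to algC by comparing ranks of integer matrices. *)

Set Implicit Arguments.
Unset Strict Implicit.
Unset Printing Implicit Defensive.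

Import Order.TTheory GRing.Theory Num.Theory.
Local Open Scope ring_scope.

(** * Chain complexes of convex families of faces *)

Section ChainComplex.

Variables (V : finType) (r : V -> nat).
Implicit Types (P : {set {set V}}) (tau : {set V}) (v w : V).

Definition pos tau v : nat := #|[set w in tau | (r w < r v)%N]|.

Lemma pos_setU1 tau w v : w \notin tau ->
  pos (w |: tau) v = ((r w < r v) + pos tau v)%N.
Proof.
move=> wtau; rewrite /pos; have [lt_wv|le_vw] := boolP (r w < r v)%N.
  rewrite (_ : [set u in w |: tau | _] = w |: [set u in tau | (r u < r v)%N]).
    by rewrite cardsU1 inE (negPf wtau).
  by apply/setP=> u; rewrite !inE; have [->|] := eqVneq u w.
apply: eq_card => u; rewrite !inE.
by have [->|] := eqVneq u w; rewrite //= (negPf le_vw) (negPf wtau).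
Qed.

Definition convex P := forall rho sigma tau : {set V},
  rho \subset sigma -> sigma \subset tau -> rho \in P -> tau \in P -> sigma \in P.

(** Injectivity is asked on single faces only: [r] will be the color, which many vertices share. *)
Definition orderable P := forall tau, tau \in P -> {in tau &, injective r}.

Definition level P (k : nat) : {set {set V}} := [set tau in P | #|tau| == k].

Lemma levelP P k tau : tau \in level P k -> tau \in P /\ #|tau| = k.
Proof. by rewrite inE => /andP[-> /eqP]. Qed.

Section Coefficients.

Variable K : fieldType.
Implicit Types (c b : {set V} -> K).

Definition supported (Q : {set {set V}}) c := forall tau, tau \notin Q -> c tau = 0.

(* Chains are coefficient functions here, so this is the boundary map of Defs,
   for vertices ordered by [r], in transposed form. *)
Definition bd P c tau : K :=
  if tau \in P then \sum_(v | v \notin tau) (-1) ^+ pos (v |: tau) v * c (v |: tau)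
  else 0.

(** Degrees are counted by cardinality: position [k] is homological degree [k - 1], and the empty
    face sits at [k = 0]. *)
Definition exact_at P (k : nat) := forall c,
  supported (level P k) c -> (forall tau, bd P c tau = 0) ->
  exists2 b, supported (level P k.+1) b & forall tau, bd P b tau = c tau.

Lemma eq_bd P c b : c =1 b -> bd P c =1 bd P b.
Proof.
by move=> eq_cb tau; rewrite /bd; case: ifP => // _; apply: eq_bigr => v _; rewrite eq_cb.
Qed.

Lemma bdB P c b tau : bd P (fun sigma => c sigma - b sigma) tau = bd P c tau - bd P b tau.
Proof.
rewrite /bd; case: ifP => _; last by rewrite subr0.
by rewrite -sumrB; apply: eq_bigr => v _; rewrite mulrBr.
Qed.

Lemma bd_supported P k c : supported (level P k.+1) c -> supported (level P k) (bd P c).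
Proof.
move=> sc tau; rewrite inE /bd; case: ifP => //= _ tauk; apply: big1 => v vtau.
by rewrite sc ?mulr0 // inE cardsU1 vtau add1n eqSS (negPf tauk) andbF.
Qed.

Lemma sub_supported (Q Q' : {set {set V}}) c : Q \subset Q' -> supported Q c -> supported Q' c.
Proof. by move=> /subsetP sQ sc tau tauQ; apply/sc/(contra (sQ _)). Qed.

End Coefficients.

(** The two orders of deleting a pair of vertices contribute with opposite signs. Convexity puts the
    intermediate face in [P]; in characteristic zero a sum equal to its own negative vanishes. *)
Lemma bd_bd (K : numFieldType) P (c : {set V} -> K) tau :
  convex P -> orderable P -> supported P c -> bd P (bd P c) tau = 0.
Proof.
move=> cP oP sc; rewrite {1}/bd; case: ifP => // Ptau.
pose X v w : K := if (v \notin tau) && (w \notin v |: tau) then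
  (-1) ^+ pos (v |: tau) v * ((-1) ^+ pos (w |: (v |: tau)) w * c (w |: (v |: tau))) else 0.
have -> : \sum_(v | v \notin tau) (-1) ^+ pos (v |: tau) v * bd P c (v |: tau) =
    \sum_v \sum_w X v w.
  rewrite big_mkcond; apply: eq_bigr => v _; rewrite /X.
  case: ifP => vtau /=; last by rewrite big1.
  rewrite -big_mkcond /= /bd; case: ifP => [_|/negP Pv]; first by rewrite mulr_sumr.
  rewrite mulr0 big1 // => w _; rewrite sc ?mulr0 //; apply/negP => Pw; apply: Pv.
  exact: cP (subsetUr _ _) (subsetUr _ _) Ptau Pw.
have antiX v w : X v w = - X w v.
  rewrite /X !inE !negb_or; have [->|ne_wv] := eqVneq w v; first by rewrite !andbF oppr0.
  rewrite /= andbC; case: ifP => [/andP[wtau vtau]|_]; last by rewrite oppr0.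
  have [Pwv|Pwv] := boolP (w |: (v |: tau) \in P); last first.
    by rewrite [v |: (w |: tau)]setUCA sc // !mulr0 oppr0.
  have: r v != r w.
    by apply: contra ne_wv => /eqP/(oP _ Pwv)-> //; rewrite !inE eqxx ?orbT.
  have vw : v \notin w |: tau by rewrite !inE negb_or vtau andbT eq_sym.
  have wv : w \notin v |: tau by rewrite !inE negb_or wtau andbT.
  (* Once the positions are expanded, the two exponents differ only in the terms [r v < r w] and
     [r w < r v], exactly one of which is 1. *)
  rewrite [v |: (w |: tau)]setUCA [in RHS]setUCA !pos_setU1 // setUCA !ltnn !add0n.
  rewrite !mulrA -!exprD -mulNr.
  by case: ltngtP => // _ _; rewrite add0n add1n addnS exprS mulN1r ?opprK addnC.
have: \sum_v \sum_w X v w = - \sum_v \sum_w X v w.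
  rewrite {1}exchange_big -sumrN; apply: eq_bigr => w _; rewrite -sumrN.
  by apply: eq_bigr.
by move/eqP; rewrite -addr_eq0 -mulr2n mulrn_eq0 => /orP[//|/eqP].
Qed.

End ChainComplex.

(** * Exactness of the complexes given by color intervals *)

Section RankSelection.

Variables (V : finType) (d : nat) (Phi : balancedRelComplex V d).
Implicit Types (A B : {set 'I_d}) (sigma tau : {set V}).

Definition colorn (v : V) : nat := color Phi v.

(** The link of [sigma] with [sigma] joined back to each face: the same complex up to signs and a
    degree shift by [#|sigma|], but made of faces of [Phi], on which colors order the vertices. *)
Definition star sigma : {set {set V}} := [set tau in Phi | sigma \subset tau].

Definition color_interval A B : {set {set V}} :=
  [set tau in Phi | (A \subset color Phi @: tau) && (color Phi @: tau \subset B)].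

Lemma color_intervalP A B tau :
  reflect [/\ tau \in Phi, A \subset color Phi @: tau & color Phi @: tau \subset B]
    (tau \in color_interval A B).
Proof. by rewrite inE; apply: and3P. Qed.

Lemma orderable_sub (P : {set {set V}}) : P \subset Phi -> orderable colorn P.
Proof.
move=> /subsetP sP tau /sP Phi_tau v w tv tw /val_inj.
exact: (faces_balanced Phi_tau).
Qed.

Lemma color_interval_orderable A B : orderable colorn (color_interval A B).
Proof. by apply: orderable_sub; apply/subsetP => tau /color_intervalP[]. Qed.

Lemma color_interval_convex A B : convex (color_interval A B).
Proof.
move=> rho sigma tau rs st /color_intervalP[Pr Ar _] /color_intervalP[Pt _ tB].
apply/color_intervalP; split; first exact: faces_convex Pr Pt.
  exact: subset_trans Ar (imsetS _ rs).
exact: subset_trans (imsetS _ st) tB.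
Qed.

Variables (K : numFieldType) (l : nat).

(** A chase in the long exact sequence of the pair: the quotient complex consists of the faces that
    contain color [c], and its homology at [k.+1] maps to that of the subcomplex at [k]. *)
Lemma exact_color_interval_step A B c k : c \notin B ->
  exact_at colorn K (color_interval A (c |: B)) k ->
  exact_at colorn K (color_interval (c |: A) (c |: B)) k.+1 ->
  exact_at colorn K (color_interval A B) k.
Proof.
move=> cB ex1 ex2 z sz dz.
have sfB : level (color_interval A B) k \subset level (color_interval A (c |: B)) k.
  apply/subsetP => tau; rewrite !inE => /andP[/and3P[-> -> sB] ->].
  by rewrite (subset_trans sB) ?subsetUr.
have cB_notin tau : c \in color Phi @: tau -> z tau = 0.
  move=> ct; apply: sz; rewrite !inE; apply/negP => /andP[/and3P[_ _ /subsetP sB] _].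
  by move: cB; rewrite sB.
have [tau|b sb db] := ex1 z (sub_supported sfB sz).
  rewrite /bd; case: ifP => // /color_intervalP[Pt At tcB].
  have [ct|ct] := boolP (c \in color Phi @: tau).
    by apply: big1 => v _; rewrite cB_notin ?mulr0 // imsetU1 inE ct orbT.
  rewrite -[RHS](dz tau) /bd ifT //; apply/color_intervalP; split=> //.
  apply/subsetP => e et; move/subsetP/(_ e et): tcB.
  by rewrite !inE; case: eqP et ct => // -> ->.
(* The part of [b] on faces with color [c] is a cycle of the quotient, because [z] vanishes on such
   faces. *)
pose bc tau := if c \in color Phi @: tau then b tau else 0.
have [tau|tau|u su du] := ex2 bc.
- rewrite /bc; case: ifP => // ct; rewrite !inE subUset sub1set ct /= => H.
  by apply: sb; rewrite !inE.
- rewrite /bd; case: ifP => // /color_intervalP[Pt]; rewrite subUset sub1set => /andP[ct At] tB.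
  have := db tau; rewrite cB_notin // /bd ifT; last by apply/color_intervalP.
  move=> {2}<-; apply: eq_bigr => v _.
  by rewrite /bc imsetU1 inE ct orbT.
have sfA : level (color_interval (c |: A) (c |: B)) k.+2 \subset level (color_interval A (c |: B)) k.+2.
  apply/subsetP => tau; rewrite !inE subUset => /andP[/and3P[-> /andP[_ ->] ->] ->] //.
have su' := sub_supported sfA su.
(* Subtracting the boundary of [u] clears [b] on all faces with color [c] and leaves its boundary
   equal to [z]. *)
pose P := color_interval A (c |: B); pose b' tau := b tau - bd colorn P u tau.
have b'c tau : c \in color Phi @: tau -> b' tau = 0.
  move=> ct; rewrite /b'; have [Pt|Pt] := boolP (tau \in P); last first.
    by rewrite /bd (negPf Pt) subr0 sb // inE (negPf Pt).
  have := du tau; rewrite /bc ct => <-.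
  have /color_intervalP[Pt' At tB] := Pt.
  rewrite /bd Pt ifT ?subrr //; apply/color_intervalP; split => //.
  by rewrite subUset sub1set ct.
have sb' : supported (level P k.+1) b'.
  by move=> tau Pt; rewrite /b' sb // (bd_supported colorn su') ?subr0.
exists b' => [tau|tau].
  have [/b'c-> //|ct] := boolP (c \in color Phi @: tau).
  move=> Pt; apply: sb'; apply: contra Pt; rewrite !inE => /andP[/and3P[-> -> tB] ->].
  rewrite andbT /=; apply/subsetP => e et; move/subsetP/(_ e et): tB.
  by rewrite !inE; case: eqP et ct => // -> ->.
have dP : bd colorn P b' tau = z tau.
  rewrite bdB db bd_bd ?subr0 //; first exact: color_interval_convex.
    exact: color_interval_orderable.
  by apply: sub_supported su'; apply/subsetP => t /levelP[].
rewrite -dP {1}/bd; case: ifP => [/color_intervalP[Pt At tB]|Pt].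
  by rewrite /bd ifT //; apply/color_intervalP; split=> //; apply: subset_trans tB (subsetUr _ _).
by rewrite dP sz // inE Pt.
Qed.

(** The differential never deletes a vertex with color in [A], so the complex is the direct sum of
    the stars of the faces [sigma] with color set exactly [A], each of cardinality [#|A|]. *)
Lemma exact_color_interval_full A k : (k < d)%N -> (k < #|A| + l)%N ->
  (forall sigma tau, tau \in Phi -> sigma \subset tau -> (k < #|sigma| + l)%N ->
     exact_at colorn K (star sigma) k) ->
  exact_at colorn K (color_interval A setT) k.
Proof.
move=> kd kA ex z sz dz.
pose apart tau := [set v in tau | color Phi v \in A].
have apartU sigma tau : tau \in Phi -> sigma \subset tau -> color Phi @: sigma = A ->
    apart tau = sigma.
  move=> Pt /subsetP st sA; apply/setP => v; rewrite inE; apply/andP/idP => [[vt]|vs].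
    by rewrite -sA => /imsetP[w ws] /(faces_balanced Pt vt (st _ ws))->.
  by rewrite st // -sA imset_f.
have apartA tau : tau \in color_interval A setT -> color Phi @: apart tau = A.
  move=> /color_intervalP[Pt /subsetP At _]; apply/setP => e; apply/imsetP/idP => [[v]|eA].
    by rewrite inE => /andP[_ ?] ->.
  by have /imsetP[v vt def_e] := At e eA; exists v; rewrite // inE vt -def_e.
have apart_sub tau : apart tau \subset tau by apply/subsetP => v; rewrite inE => /andP[].
have apartV tau v : tau \in color_interval A setT -> v |: tau \in Phi -> apart (v |: tau) = apart tau.
  move=> Ft Pv; apply: apartU => //; last exact: apartA.
  exact: subset_trans (apart_sub _) (subsetUr _ _).
have famV tau v : tau \in color_interval A setT -> v |: tau \in Phi -> v |: tau \in color_interval A setT.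
  move=> /color_intervalP[Pt At _] Pv; apply/color_intervalP; split; rewrite ?subsetT //.
  by rewrite imsetU1; apply: subset_trans At (subsetUr _ _).
have starF sigma tau : color Phi @: sigma = A -> tau \in star sigma -> tau \in color_interval A setT.
  move=> sA; rewrite inE => /andP[Pt st]; apply/color_intervalP; split; rewrite ?subsetT //.
  by rewrite -sA imsetS.
(* The cycle is bounded star by star. A set [sigma] that is not the [A]-colored part of any face
   gets the zero chain, so that a choice exists for every [sigma]. *)
have exs sigma : exists b, supported (level (star sigma) k.+1) b /\
    (forall tau, tau \in color_interval A setT -> apart tau = sigma -> bd colorn (star sigma) b tau = z tau).
  have [/exists_inP[tau tF as_]|no] := boolP [exists tau in color_interval A setT, apart tau == sigma]; last first.
    exists (fun _ => 0); split => // tau tF as_; case/negP: no.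
    by apply/existsP; exists tau; rewrite tF as_ eqxx.
  have sA : color Phi @: sigma = A by rewrite -(eqP as_) apartA.
  have /color_intervalP[Pt _ _] := tF.
  have st : sigma \subset tau by rewrite -(eqP as_).
  have cs : #|sigma| = #|A|.
    rewrite -sA card_in_imset // => v w /(subsetP st) vt /(subsetP st) wt.
    exact: (faces_balanced Pt).
  have zU t v : t \in star sigma -> v |: t \notin star sigma -> z (v |: t) = 0.
    rewrite !inE => /andP[_ st'] nst; apply: sz; apply: contra nst => /levelP[/color_intervalP[-> _ _] _].
    by rewrite (subset_trans st') ?subsetUr.
  have ks : (k < #|sigma| + l)%N by rewrite cs.
  have [||b sb db] := ex _ _ Pt st ks (fun t => if t \in star sigma then z t else 0).
  - move=> t; case: ifP => // ts lt; apply: sz; apply: contra lt.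
    by rewrite inE => /andP[_ tk]; rewrite inE ts.
  - move=> t; rewrite /bd; case: ifP => // ts.
    rewrite -[RHS](dz t) /bd (starF _ _ sA ts); apply: eq_bigr => v _.
    by case: ifP => // /negbT/(zU _ _ ts)->.
  exists b; split => // t tF' ast; rewrite db ifT // inE.
  by have /color_intervalP[-> _ _] := tF'; rewrite -ast apart_sub.
have /fin_all_exists[b bP] := exs.
have sb sigma := (bP sigma).1; have db sigma := (bP sigma).2.
(* Gluing: each face takes its coefficient from the chain chosen for its own [A]-colored part. *)
pose bb tau := if tau \in level (color_interval A setT) k.+1 then b (apart tau) tau else 0.
exists bb => [tau|tau]; first by rewrite /bb => /negPf->.
have [tF|tF] := boolP (tau \in color_interval A setT); last first.
  by rewrite /bd (negPf tF) sz // inE (negPf tF).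
rewrite -(db _ tau tF erefl) /bd tF ifT; last first.
  by have /color_intervalP[Pt _ _] := tF; rewrite inE Pt apart_sub.
apply: eq_bigr => v _; congr (_ * _); rewrite /bb; case: ifP => vF.
  by rewrite apartV //; have /levelP[/color_intervalP[]] := vF.
rewrite sb //; apply/negP => /levelP[]; rewrite inE => /andP[Pv _] vk.
by case/negP: vF; rewrite inE vk eqxx famV.
Qed.

(** Induction on the number of colors missing from [B]. Both bounds on [k] survive the step: for the
    quotient, [k], [#|A|] and [#|B|] all grow by one. *)
Lemma exact_color_interval A B k : A \subset B -> (k < #|B|)%N -> (k < #|A| + l)%N ->
  (forall sigma tau j, tau \in Phi -> sigma \subset tau -> (j < d)%N -> (j < #|sigma| + l)%N ->
     exact_at colorn K (star sigma) j) ->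
  exact_at colorn K (color_interval A B) k.
Proof.
move=> sAB kB kA ex; have [n] := ubnP #|~: B|.
elim: n => // n IHn in A B k sAB kB kA *; rewrite ltnS => leBn.
have [BT|] := eqVneq B setT.
  rewrite BT; apply: exact_color_interval_full => //; first by rewrite BT cardsT card_ord in kB.
  by move=> sigma tau Pt st ks; apply: ex Pt st _ ks; rewrite BT cardsT card_ord in kB.
rewrite -subTset => /subsetPn[c _ cB].
have cA : c \notin A by apply: contra cB; apply/subsetP.
have ltn : (#|~: (c |: B)| < n)%N.
  apply: leq_trans leBn; apply: proper_card; rewrite properE setCS subsetUr /=.
  by apply/subsetPn; exists c; rewrite !inE ?eqxx.
apply: (exact_color_interval_step cB); apply: IHn => //.
- exact: subset_trans sAB (subsetUr _ _).
- by rewrite cardsU1 cB add1n ltnS ltnW.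
- exact: setUS.
- by rewrite cardsU1 cB.
- by rewrite cardsU1 cA.
Qed.

End RankSelection.

(** * Vanishing homology as exactness for coefficient functions *)

Section HomologyCoefficients.

Variables (F : fieldType) (V : finType) (Psi : {set {set V}}).

Definition enumr (v : V) : nat := enum_rank v.

(** In the coefficient of [tau], each vertex [v] outside [tau] contributes through
    [sigma = v |: tau] only. *)
Lemma boundary_funE (c : chain_vec F V) tau :
  supported Psi c -> boundary_fun Psi c tau = bd enumr Psi c tau.
Proof.
move=> sc; rewrite /boundary_fun sum_ffunE /bd.
have [Pt|Pt] := boolP (tau \in Psi); last first.
  apply: big1 => sigma _; rewrite sum_ffunE; apply: big1 => v /andP[_ Pv].
  by rewrite !ffunE; case: eqP Pv Pt => [-> ->|_ _ _] //; rewrite scaler0.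
transitivity (\sum_(sigma : {set V}) \sum_(v in sigma)
    c sigma * (-1) ^+ pos enumr sigma v * (tau == sigma :\ v)%:R).
  rewrite big_mkcond; apply: eq_bigr => sigma _; case: ifP => Ps; last first.
    by rewrite big1 // => v _; rewrite sc ?Ps ?mul0r.
  rewrite sum_ffunE big_mkcondr; apply: eq_bigr => v vs.
  case: ifP => [_|]; first by rewrite !ffunE.
  by case: eqP => [<-|_ _]; rewrite ?Pt ?mulr0.
rewrite (exchange_big_dep xpredT) //= [RHS]big_mkcond; apply: eq_bigr => v _.
case: ifP => vt; last first.
  apply: big1 => sigma vs; case: eqP => [def_t|_]; last by rewrite mulr0.
  by rewrite def_t !inE eqxx in vt.
rewrite (bigD1 (v |: tau)) ?setU11 //= setU1K // eqxx mulr1 mulrC big1 ?addr0 //.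
move=> sigma /andP[vs ne]; case: (tau =P _) => [def_t|_]; last by rewrite mulr0.
by case/eqP: ne; rewrite def_t setD1K.
Qed.

Lemma supported_chains (c : chain_vec F V) k :
  reflect (supported (level Psi k) c) (c \in chains F Psi (k%:Z - 1)).
Proof.
apply: (iffP idP) => [|sc].
  rewrite /chains; set X := map _ _ => /(coord_span (X := in_tuple X)) -> tau tauP.
  rewrite sum_ffunE big1 // => i _; rewrite ffunE.
  have : X`_i \in X by rewrite mem_nth.
  case/mapP => sigma; rewrite mem_filter mem_enum subrK => /andP[sk Ps] ->.
  rewrite ffunE; case: eqP => [eq_ts|_]; last by rewrite scaler0.
  by case/negP: tauP; rewrite eq_ts inE Ps -eqz_nat.
have -> : c = \sum_sigma c sigma *: (face_vec F sigma : chain_vec F V).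
  apply/ffunP => tau; rewrite sum_ffunE (bigD1 tau) //= big1 => [|sigma ne].
    by rewrite addr0 !ffunE eqxx [RHS]mulr1.
  by rewrite !ffunE eq_sym (negPf ne) [LHS]mulr0.
apply: memv_suml => sigma _; have [/levelP[Ps sk]|/sc->] := boolP (sigma \in level Psi k).
  apply/memvZ/memv_span/map_f; rewrite mem_filter mem_enum Ps subrK sk eqxx //.
by rewrite scale0r mem0v.
Qed.

Lemma homology_vanishes_exact k :
  homology_vanishes F Psi (k%:Z - 1) -> exact_at enumr F Psi k.
Proof.
move=> /subvP hv c sc dc; pose cv : chain_vec F V := [ffun tau => c tau].
have eq_cv : cv =1 c by move=> tau; rewrite ffunE.
have scv : supported (level Psi k) cv by move=> tau tk; rewrite eq_cv sc.
have sub_level j : level Psi j \subset Psi by apply/subsetP => t /levelP[].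
have : cv \in cycles F Psi (k%:Z - 1).
  rewrite /cycles memv_cap (introT (supported_chains _ _) scv) /= memv_ker lfunE /=.
  apply/eqP/ffunP => tau; rewrite boundary_funE.
    by rewrite [RHS]ffunE; exact: etrans (eq_bd _ _ eq_cv tau) (dc tau).
  exact: sub_supported (sub_level k) scv.
move=> /hv; rewrite /boundaries (_ : k%:Z - 1 + 1 = k.+1%:Z - 1); last first.
  by rewrite subrK -addn1 PoszD addrK.
case/memv_imgP => b /supported_chains sb; rewrite lfunE /= => def_c.
exists b => // tau; rewrite -eq_cv def_c; symmetry; apply: boundary_funE.
exact: sub_supported (sub_level _) sb.
Qed.

End HomologyCoefficients.

(** * Ranks of integer matrices over different fields *)

Section IntegerRank.

Lemma mxrank_mxsub (K : fieldType) m n p q (f : 'I_p -> 'I_m) (g : 'I_q -> 'I_n)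
  (A : 'M[K]_(m, n)) : (\rank (mxsub f g A) <= \rank A)%N.
Proof.
have leq_rowsub m' n' p' (h : 'I_p' -> 'I_m') (B : 'M[K]_(m', n')) : (\rank (rowsub h B) <= \rank B)%N.
  by rewrite rowsubE mxrankM_maxr.
have -> : mxsub f g A = (rowsub g (rowsub f A)^T)^T by apply/matrixP => i j; rewrite !mxE.
by rewrite mxrank_tr (leq_trans (leq_rowsub _ _ _ _ _)) // mxrank_tr.
Qed.

(* A nonvanishing minor over [F] comes from a nonzero integer minor. *)
Lemma mxrank_intr (F : fieldType) (K : numFieldType) m n (A : 'M[int]_(m, n)) :
  (\rank (map_mx intr A : 'M[F]_(m, n)) <= \rank (map_mx intr A : 'M[K]_(m, n)))%N.
Proof.
set AF : 'M[F]_(m, n) := map_mx intr A; set AK : 'M[K]_(m, n) := map_mx intr A.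
have fullB : row_full (rowsub (maxrankfun AF) AF)^T.
  by rewrite /row_full mxrank_tr; apply: maxrowsub_free.
(* Independent rows [f], then columns [g], cut out an invertible square minor whose size is the rank
   over [F]. *)
have := fullrowsub_unit fullB; set g := fullrankfun fullB; set f := maxrankfun AF.
have minorE (R : fieldType) : rowsub g (rowsub f (map_mx intr A : 'M[R]_(m, n)))^T =
    map_mx intr (mxsub f g A)^T by apply/matrixP => i j; rewrite !mxE.
rewrite minorE unitmxE det_map_mx unitfE => nz.
suff uK : (mxsub f g AK)^T \in unitmx.
  by have := mxrank_mxsub f g AK; rewrite -mxrank_tr mxrank_unit.
have -> : (mxsub f g AK)^T = map_mx intr (mxsub f g A)^T.
  by apply/matrixP => i j; rewrite !mxE.
rewrite unitmxE det_map_mx unitfE intr_eq0.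
by apply: contraNneq nz => ->; rewrite rmorph0.
Qed.

End IntegerRank.

(** * Boundary matrices and the passage to characteristic zero *)

Section BoundaryMatrix.

Variables (V : finType) (r : V -> nat).
Implicit Types (P Q : {set {set V}}) (tau : {set V}).

Local Notation n := #|{: {set V}}|.

(** Diagonal projection, acting on row vectors, whose row space is the chains supported on [Q]. Its
    entries are integers, so it can be compared across fields. *)
Definition ind_mx (R : nzRingType) Q : 'M[R]_n :=
  \matrix_(i, j) ((i == j) && (enum_val i \in Q))%:R.

Definition bd_mx (R : nzRingType) P : 'M[R]_n := \matrix_(i, j)
  if enum_val j \in P then \sum_(v | v \notin enum_val j)
    (-1) ^+ pos r (v |: enum_val j) v * (enum_val i == v |: enum_val j)%:R
  else 0.

Lemma map_ind_mx (R : nzRingType) Q : map_mx intr (ind_mx int Q) = ind_mx R Q.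
Proof. by apply/matrixP => i j; rewrite !mxE; case: (_ && _). Qed.

Lemma map_bd_mx (R : nzRingType) P : map_mx intr (bd_mx int P) = bd_mx R P.
Proof.
apply/matrixP => i j; rewrite !mxE; case: ifP => // _; rewrite rmorph_sum.
by apply: eq_bigr => v _; rewrite rmorphM rmorphXn rmorphN1; case: (_ == _).
Qed.

Variable K : fieldType.
Implicit Types (c : {set V} -> K) (u : 'rV[K]_n).

Definition row_of c : 'rV[K]_n := \row_i c (enum_val i).
Definition fun_of u tau : K := u 0 (enum_rank tau).

Lemma fun_ofK u : row_of (fun_of u) = u.
Proof. by apply/rowP => i; rewrite mxE /fun_of enum_valK. Qed.

Lemma eq_row_of c b : c =1 b -> row_of c = row_of b.
Proof. by move=> e; apply/rowP => i; rewrite !mxE. Qed.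

Lemma row_of_eq c b : row_of c = row_of b -> c =1 b.
Proof. by move=> /rowP e tau; have := e (enum_rank tau); rewrite !mxE enum_rankK. Qed.

Lemma row_of_bd P c : row_of c *m bd_mx K P = row_of (bd r P c).
Proof.
apply/rowP => j; rewrite !mxE /bd; case: ifP => Pj; last first.
  by apply: big1 => i _; rewrite !mxE Pj mulr0.
transitivity (\sum_(i : 'I_n) \sum_(v | v \notin enum_val j) c (enum_val i) *
    ((-1) ^+ pos r (v |: enum_val j) v * (enum_val i == v |: enum_val j)%:R)).
  by apply: eq_bigr => i _; rewrite !mxE Pj mulr_sumr.
rewrite exchange_big; apply: eq_bigr => v _.
rewrite (bigD1 (enum_rank (v |: enum_val j))) //= big1 => [|i ne].
  by rewrite enum_rankK eqxx mulr1 addr0 mulrC.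
case: eqP => [e|_]; last by rewrite !mulr0.
by case/eqP: ne; rewrite -e enum_valK.
Qed.

Lemma row_of_ind Q c : row_of c *m ind_mx K Q = row_of (fun tau => if tau \in Q then c tau else 0).
Proof.
apply/rowP => j; rewrite !mxE (bigD1 j) //= big1 => [|i ne]; rewrite !mxE.
  by rewrite eqxx addr0; case: ifP; rewrite ?mulr1 ?mulr0.
by rewrite (negPf ne) mulr0.
Qed.

Lemma ind_mx_id Q : ind_mx K Q *m ind_mx K Q = ind_mx K Q.
Proof.
apply/row_matrixP => i; rewrite row_mul -[row i _]fun_ofK !row_of_ind.
apply: eq_row_of => tau; case: ifP => // /negbT tQ.
by rewrite /fun_of !mxE; case: eqP => // ->; rewrite enum_rankK (negPf tQ).
Qed.

Lemma sub_ind_mxP Q c : reflect (supported Q c) (row_of c <= ind_mx K Q)%MS.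
Proof.
apply: (iffP idP) => [|sc].
  case/submxP => u e tau tQ; have := congr1 (mulmx^~ (ind_mx K Q)) e.
  by rewrite -mulmxA ind_mx_id -e row_of_ind => /row_of_eq/(_ tau); rewrite (negPf tQ).
suff <- : row_of c *m ind_mx K Q = row_of c by apply: submxMl.
by rewrite row_of_ind; apply: eq_row_of => tau; case: ifP => // /negbT/sc.
Qed.

Lemma row_of_kermx P c :
  reflect (forall tau, bd r P c tau = 0) (row_of c <= kermx (bd_mx K P))%MS.
Proof.
apply: (iffP sub_kermxP) => [|e]; rewrite row_of_bd.
  by move=> e tau; apply: (row_of_eq (b := fun _ => 0)); rewrite e; apply/rowP => i; rewrite !mxE.
by apply/rowP => i; rewrite !mxE e.
Qed.

Lemma exact_mxP P k : exact_at r K P k <->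
  (ind_mx K (level P k) :&: kermx (bd_mx K P) <= ind_mx K (level P k.+1) *m bd_mx K P)%MS.
Proof.
split=> [ex|ex c sc dc].
  apply/rV_subP => u; rewrite -[u]fun_ofK sub_capmx => /andP[/sub_ind_mxP su /row_of_kermx du].
  have [b sb db] := ex _ su du.
  have /sub_ind_mxP/submxP[w def_b] := sb.
  rewrite -(eq_row_of db) -row_of_bd def_b -mulmxA; exact: submxMl.
have: (row_of c <= ind_mx K (level P k.+1) *m bd_mx K P)%MS.
  apply: submx_trans ex; rewrite sub_capmx; apply/andP; split; first exact/sub_ind_mxP.
  exact/row_of_kermx.
case/submxP => w; rewrite mulmxA -[w *m _]fun_ofK row_of_bd => /row_of_eq eb.
exists (fun_of (w *m ind_mx K (level P k.+1))) => [|tau]; last by rewrite eb.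
by apply/sub_ind_mxP; rewrite fun_ofK submxMl.
Qed.

(** The total does not depend on the field; hence an inequality between ranks over two fields, valid
    for both [Q] and its complement, is an equality. *)
Lemma rank_ind_mxC Q : (\rank (ind_mx K Q) + \rank (ind_mx K (~: Q)) = n)%N.
Proof.
have -> : ind_mx K (~: Q) = 1%:M - ind_mx K Q.
  apply/matrixP => i j; rewrite !mxE inE; case: eqP => //= _; last by rewrite subr0.
  by case: (_ \in Q); rewrite ?subrr ?subr0.
apply/eqP; rewrite eqn_leq; apply/andP; split.
  by rewrite mulmx0_rank_max // mulmxBr mulmx1 ind_mx_id subrr.
have := mxrank_add (ind_mx K Q) (1%:M - ind_mx K Q).
by rewrite addrC subrK mxrank1.
Qed.

End BoundaryMatrix.

(** Boundaries are cycles. With this inclusion known, exactness reduces to an inequality of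
    ranks. *)
Lemma ind_mx_ker_bd (V : finType) (r : V -> nat) (K : numFieldType) (P : {set {set V}}) k :
  convex P -> orderable r P ->
  (ind_mx K (level P k.+1) *m bd_mx r K P <= ind_mx K (level P k) :&: kermx (bd_mx r K P))%MS.
Proof.
move=> cP oP; apply/rV_subP => u /submxP[w ->]; rewrite mulmxA -[w *m _]fun_ofK.
set c := fun_of _; have sc : supported (level P k.+1) c.
  by apply/sub_ind_mxP; rewrite fun_ofK submxMl.
rewrite row_of_bd sub_capmx; apply/andP; split; first exact/sub_ind_mxP/bd_supported.
apply/row_of_kermx => tau; apply: bd_bd => //.
by apply: sub_supported sc; apply/subsetP => t /levelP[].
Qed.

(* Exactness at [k] amounts to rank pi_k <= rank (pi_k D) + rank (pi_(k+1) D), and the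
   rank of an integer matrix can only grow when passing to characteristic zero. *)
Lemma exact_char0 (V : finType) (r : V -> nat) (F : fieldType) (K : numFieldType)
    (P : {set {set V}}) k : convex P -> orderable r P ->
  exact_at r F P k -> exact_at r K P k.
Proof.
move=> cP oP /exact_mxP/mxrankS leF; apply/exact_mxP.
have /mxrank_leqif_sup leK := ind_mx_ker_bd K k cP oP.
rewrite -(geq_leqif leK).
have leI Q : (\rank (ind_mx F Q) <= \rank (ind_mx K Q))%N.
  by rewrite -(map_ind_mx F) -(map_ind_mx K) mxrank_intr.
have eqI Q : \rank (ind_mx F Q) = \rank (ind_mx K Q).
  apply/eqP; rewrite eqn_leq leI -(leq_add2r (\rank (ind_mx F (~: Q)))).
  rewrite (rank_ind_mxC F Q); apply: (@leq_trans (\rank (ind_mx K Q) + \rank (ind_mx K (~: Q)))).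
    by rewrite leq_add2l.
  by rewrite (rank_ind_mxC K Q).
have leD j : (\rank (ind_mx F (level P j) *m bd_mx r F P) <=
    \rank (ind_mx K (level P j) *m bd_mx r K P))%N.
  by rewrite -(map_ind_mx F) -(map_ind_mx K) -(map_bd_mx _ F) -(map_bd_mx _ K) -!map_mxM mxrank_intr.
(* By rank-nullity on both sides, the rank of the chains, equal over [F] and [K], is the rank of the
   boundary on them plus that of the cycles. *)
rewrite -(leq_add2l (\rank (ind_mx K (level P k) *m bd_mx r K P))) mxrank_mul_ker -eqI.
rewrite -(mxrank_mul_ker _ (bd_mx r F P)); apply: leq_add => //.
exact: leq_trans leF (leD _).
Qed.

(** * Change of vertex order, links and stars *)

Lemma pos_sum (V : finType) (r : V -> nat) (tau : {set V}) v :
  pos r tau v = (\sum_(w in tau) (r w < r v))%N.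
Proof. by rewrite /pos -sum1dep_card big_mkcondr; apply: eq_bigr => w _; case: (_ < _)%N. Qed.

(* [eps tau] counts the pairs of [tau] on which the two orders disagree, together
   with the pairs of [sigma * tau] ordered by [r'] with [sigma] first. *)
Lemma pos_reorder (V : finType) (r r' : V -> nat) (sigma : {set V}) : injective r ->
  exists eps : {set V} -> nat, forall (tau : {set V}) v,
    v \notin tau :|: sigma -> [disjoint tau & sigma] ->
    {in v |: (tau :|: sigma) &, injective r'} ->
  odd (pos r' (v |: (tau :|: sigma)) v) = odd (eps tau + eps (v |: tau) + pos r (v |: tau) v).
Proof.
move=> injr.
pose D u w : nat := (r u < r w)%N && (r' w < r' u)%N.
pose eps (tau : {set V}) := (\sum_(u in tau) (\sum_(w in tau) D w u + \sum_(w in sigma) (r' w < r' u)))%N.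
exists eps => tau v; rewrite inE negb_or => /andP[vt vs] dts injr'.
have epsU : eps (v |: tau) = (eps tau + \sum_(u in tau) (D v u + D u v) + \sum_(w in sigma) (r' w < r' v))%N.
  rewrite /eps big_setU1 //= big_setU1 //= {1}/D !ltnn add0n.
  rewrite [in X in (_ + X)%N](eq_bigr (fun u => D v u + (\sum_(w in tau) D w u + \sum_(w in sigma) (r' w < r' u)))%N).
    by rewrite !big_split /=; lia.
  by move=> u _; rewrite big_setU1 //= addnA.
have posE : pos r' (v |: (tau :|: sigma)) v = (\sum_(u in tau) (r' u < r' v) + \sum_(w in sigma) (r' w < r' v))%N.
  rewrite pos_sum big_setU1 /=; last by rewrite inE negb_or vt.
  rewrite ltnn add0n -bigU //=; apply: eq_bigl => u; exact: in_setU.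
(* Modulo 2, the number of pairs [u], [v] on which the orders disagree converts the count for [r]
   into that for [r']. *)
have sumE : (\sum_(u in tau) (D v u + D u v) + \sum_(u in tau) (r u < r v) =
    \sum_(u in tau) (r' u < r' v) + (\sum_(u in tau) D u v).*2)%N.
  rewrite -muln2 big_distrl -!big_split; apply: eq_bigr => u ut /=.
  have ne : r u != r v by apply: contraNneq vt => /injr <-.
  have ne' : r' u != r' v.
    apply: contraNneq vt => e; rewrite -(injr' u v) // !inE ?eqxx // ut !orbT //.
  rewrite /D; move: ne ne'; case: (ltngtP (r u) (r v)) => // _ _;
    case: (ltngtP (r' u) (r' v)) => // _ _; lia.
rewrite posE epsU pos_sum big_setU1 //= ltnn add0n.
have -> : (eps tau + (eps tau + \sum_(u in tau) (D v u + D u v) + \sum_(w in sigma) (r' w < r' v)) +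
   \sum_(i in tau) (r i < r v) = (eps tau).*2 + (\sum_(u in tau) (D v u + D u v) + \sum_(i in tau) (r i < r v)) +
    \sum_(w in sigma) (r' w < r' v))%N by lia.
by rewrite sumE !oddD !odd_double addbF.
Qed.

(** Joining [sigma] to the faces of the link gives the faces of the star. The sign [eps] of
    [pos_reorder] makes this bijection commute with the boundaries, taken in the enumeration order
    on the link and in the color order on the star. *)
Lemma exact_star (V : finType) (d : nat) (Phi : balancedRelComplex V d) (K : fieldType)
    (sigma : {set V}) (j : nat) :
  exact_at (@enumr V) K (link Phi sigma) j ->
  exact_at (colorn Phi) K (star Phi sigma) (j + #|sigma|).
Proof.
move=> ex c sc dc; set L := link Phi sigma; set S := star Phi sigma.
have inj_enum : injective (@enumr V) by move=> v w /val_inj/enum_rank_inj.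
have [eps epsP] := pos_reorder (colorn Phi) sigma inj_enum.
have linkP tau : tau \in L -> [/\ [disjoint tau & sigma], tau :|: sigma \in S & (tau :|: sigma) :\: sigma = tau].
  rewrite inE -disjoints_subset => /andP[dts Pts].
  split=> //; first by rewrite inE Pts subsetUr.
  by rewrite setDUl setDv setU0; apply/setDidPl.
have starP tau : tau \in S -> tau :\: sigma \in L /\ (tau :\: sigma) :|: sigma = tau.
  rewrite !inE => /andP[Pt st]; have e : tau :\: sigma :|: sigma = tau.
    by rewrite setUC -{1}(setIidPr st) setID.
  by rewrite e Pt subDset setUCr subsetT.
pose T (b : {set V} -> K) tau := if tau \in L then (-1) ^+ eps tau * b (tau :|: sigma) else 0.
have bdT b tau : supported S b -> bd (@enumr V) L (T b) tau = T (bd (colorn Phi) S b) tau.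
  move=> sb; rewrite /bd /T; case: ifP => // Lt.
  have [dts Sts _] := linkP _ Lt; rewrite Sts mulr_sumr (bigID (mem sigma)) /=.
  rewrite big1 ?add0r => [|v /andP[vt vs]]; last first.
    rewrite ifN ?mulr0 //; apply/negP => /linkP[/pred0P/(_ v)].
    by rewrite /= !inE eqxx vs.
  apply: eq_big => v; first by rewrite inE negb_or.
  move=> /andP[vt vs]; rewrite -setUA; have [Lvt|Lvt] := boolP (v |: tau \in L); last first.
    rewrite sb ?mulr0 //; apply: contra Lvt => Sv.
    have [/= Lv _] := starP _ Sv; move: Lv.
    rewrite setUA setDUl setDv setU0 (setDidPl _) //.
    by rewrite disjoints_subset subUset sub1set inE vs -disjoints_subset.
  rewrite !mulrA; congr (_ * _); rewrite -!exprD -signr_odd -[RHS]signr_odd; congr (_ ^+ _).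
  have [dv Sv _] := linkP _ Lvt.
  rewrite [in RHS]oddD epsP // ?inE ?negb_or ?vt //; last first.
    by rewrite setUA; apply: orderable_sub _ _ Sv; apply/subsetP => t; rewrite inE => /andP[].
  by rewrite !oddD; do 3!case: odd.
have sS k : level S k \subset S by apply/subsetP => t /levelP[].
have cardD tau : tau \in S -> #|tau| = (#|tau :\: sigma| + #|sigma|)%N.
  rewrite inE => /andP[_ st]; rewrite cardsD (setIidPr st) subnK //; exact: subset_leq_card.
have cardU tau : tau \in L -> #|tau :|: sigma| = (#|tau| + #|sigma|)%N.
  by move=> /linkP[dts _ _]; rewrite cardsU disjoint_setI0 // cards0 subn0.
have [tau|tau|b' sb' db'] := ex (T c).
- rewrite /T inE -/L; case: ifP => //= Lt tj; rewrite sc ?mulr0 //.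
  by apply: contra tj => /levelP[_]; rewrite cardU // => /addIn->.
- rewrite bdT; last exact: sub_supported sc.
  by rewrite /T dc mulr0 if_same.
pose b tau := if tau \in S then (-1) ^+ eps (tau :\: sigma) * b' (tau :\: sigma) else 0.
have Tb : T b =1 b'.
  move=> tau; rewrite /T /b; case: ifP => [Lt|/negbT Lt]; last first.
    by rewrite sb' //; apply: contra Lt => /levelP[].
  have [_ -> ->] := linkP _ Lt; exact: signrMK.
have sb : supported (level S (j + #|sigma|).+1) b.
  move=> tau nS; rewrite /b; case: ifP => // St; rewrite sb' ?mulr0 //.
  by apply: contra nS => /levelP[_ tj]; rewrite inE St cardD // tj addSn eqxx.
exists b => // tau; have [St|St] := boolP (tau \in S); last first.
  by rewrite [LHS]/bd (negPf St) sc // inE (negPf St).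
have [Lt e] := starP _ St.
have := bdT b (tau :\: sigma) (sub_supported (sS _) sb).
rewrite (eq_bd _ _ Tb) db' /T Lt e => /(congr1 (GRing.mul ((-1) ^+ eps (tau :\: sigma)))).
by rewrite !signrMK.
Qed.

Lemma serre_exact_star (V : finType) (d : nat) (Phi : balancedRelComplex V d)
    (F : fieldType) (K : numFieldType) (l : nat) :
  serre_condition F Phi l ->
  forall (sigma tau : {set V}) k, tau \in Phi -> sigma \subset tau ->
    (k < d)%N -> (k < #|sigma| + l)%N -> exact_at (colorn Phi) K (star Phi sigma) k.
Proof.
move=> serre sigma tau k Pt st kd kl.
have [ks|sk] := ltnP k #|sigma|.
  (* Every face of the star has at least [#|sigma|] vertices, so there are no nonzero chains
     here. *)
  move=> c sc dc; exists (fun _ => 0) => // t.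
  rewrite [LHS]/bd big1 ?if_same => [|v _]; last by rewrite mulr0.
  rewrite sc //; apply: contraL ks => /levelP[]; rewrite inE -leqNgt => /andP[_ /subset_leq_card].
  by move=> + <-.
rewrite -(subnK sk); apply: exact_star.
apply: (exact_char0 (F := F)).
- move=> t1 t2 t3 s12 s23; rewrite !inE => /andP[_ P1] /andP[t3s P3].
  rewrite (subset_trans s23) //=; apply: faces_convex P1 P3; exact: setSU.
- by move=> t _ v w _ _ /val_inj/enum_rank_inj.
apply: homology_vanishes_exact; apply: (serre _ _ Pt st).
rewrite le_min; apply/andP; split; last by lia.
(* Purity yields a face of the link with [d - #|sigma|] vertices, so [k < d] gives the dimension
   bound of the Serre condition. *)
have [m [Pm tm cm]] := faces_pure Pt.
have lm : (d - #|sigma| <= \max_(t in link Phi sigma) #|t|)%N.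
  have sm := subset_trans st tm.
  have e : m :\: sigma :|: sigma = m by rewrite setUC -{1}(setIidPr sm) setID.
  apply: leq_trans (@leq_bigmax_cond _ _ (fun t : {set V} => #|t|) (m :\: sigma) _).
    by rewrite cardsD (setIidPr sm) cm.
  by rewrite inE e Pm subDset setUCr subsetT.
by rewrite /dim_collection; lia.
Qed.

(** * Traces on invariant row spaces *)

Section SubspaceTrace.

Variables (K : fieldType) (n : nat).
Implicit Types (U W E x f : 'M[K]_n).

(* The trace of [x] on the row space of [U], provided that [x] stabilizes it. *)
Definition sub_trace U x : K := \tr (x *m (pinvmx U *m U)).

Lemma mulmx_proj U : U *m (pinvmx U *m U) = U.
Proof. by rewrite mulmxA mulmxKpV. Qed.

(** Any projector [E] onto the row space of [U] computes the same trace, by cyclicity; the one built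
    from [pinvmx] is just a choice. *)
Lemma sub_traceE U E x : (U *m x <= U)%MS -> (E <= U)%MS -> U *m E = U -> \tr (x *m E) = sub_trace U x.
Proof.
move=> Ux sE UE; rewrite /sub_trace; set E' := pinvmx U *m U.
have EE' : E *m E' = E.
  by case/submxP: sE => w ->; rewrite -mulmxA mulmx_proj.
have E'xE : E' *m x *m E = E' *m x.
  have /submxP[w ->] : (E' *m x <= U)%MS by rewrite -mulmxA (submx_trans (submxMl _ _)).
  by rewrite -mulmxA UE.
by rewrite -{1}EE' mulmxA mxtrace_mulC mulmxA E'xE mxtrace_mulC.
Qed.

Lemma eq_sub_trace U W x : (U *m x <= U)%MS -> (U == W)%MS -> sub_trace U x = sub_trace W x.
Proof.
move=> Ux /andP[sUW sWU]; symmetry; apply: sub_traceE => //.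
  exact: submx_trans (submxMl _ _) sWU.
by case/submxP: sUW => w def_U; rewrite [in LHS]def_U -mulmxA mulmx_proj.
Qed.

(* If [Y] splits [f] on the image [U *m f], then [u |-> u - u *m f *m Y] projects [U]
   onto its intersection with the kernel of [f]. *)
Lemma sub_trace_ker_im U f x : (U *m x <= U)%MS -> f *m x = x *m f ->
  sub_trace U x = sub_trace (U :&: kermx f)%MS x + sub_trace (U *m f) x.
Proof.
move=> Ux fx; have [E sEU EU] : exists2 E, (E <= U)%MS & U *m E = U.
  by exists (pinvmx U *m U); rewrite ?submxMl ?mulmx_proj.
have [Y UfY] : exists Y, U *m f *m Y *m (U *m f) = U *m f.
  by exists (pinvmx (U *m f)); rewrite mulmxKpV.
have sUE W : (W <= U)%MS -> W *m E = W by case/submxP => w ->; rewrite -mulmxA EU.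
have ExE : E *m x *m E = E *m x.
  apply: sUE; case/submxP: sEU => w ->; rewrite -mulmxA; exact: submx_trans (submxMl _ _) Ux.
(* [E - E'] projects onto the kernel part, since [E'] agrees with [E] after [f] and kills that part.
   Cyclicity of the trace replaces [E'] by the projector [Y *m (U *m f)] onto the image. *)
pose E' := E *m f *m Y *m U.
have E'f : E' *m f = E *m f.
  by case/submxP: sEU => w def_E; rewrite /E' def_E -!mulmxA; congr (_ *m _); rewrite !mulmxA -(mulmxA _ U f).
have kerE' W : (W <= U)%MS -> W *m f = 0 -> W *m E' = 0.
  by move=> sWU Wf; rewrite /E' !mulmxA sUE // Wf !mul0mx.
have trE : \tr (x *m E) = sub_trace U x by apply: sub_traceE.
have trQ : \tr (x *m (Y *m (U *m f))) = sub_trace (U *m f) x.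
  apply: sub_traceE; rewrite ?submxMl // ?mulmxA -?mulmxA.
    by rewrite fx mulmxA submxMr.
  by rewrite !mulmxA -(mulmxA _ U f).
have ker_proj : \tr (x *m (E - E')) = sub_trace (U :&: kermx f)%MS x.
  apply: sub_traceE.
  - rewrite sub_capmx (submx_trans (submxMr x (capmxSl _ _))) //=.
    apply/sub_kermxP; rewrite -mulmxA -fx mulmxA.
    by rewrite (sub_kermxP (capmxSr U (kermx f))) mul0mx.
  - rewrite sub_capmx; apply/andP; split.
      by rewrite addmx_sub // eqmx_opp submxMl.
    by apply/sub_kermxP; rewrite mulmxBl E'f subrr.
  by rewrite mulmxBr (sUE _ (capmxSl _ _)) kerE' ?capmxSl ?subr0 //; apply/sub_kermxP/capmxSr.
have im_proj : \tr (x *m E') = \tr (x *m (Y *m (U *m f))).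
  rewrite /E' mulmxA mxtrace_mulC !mulmxA sUE // -(mulmxA U x f) -fx.
  by rewrite mxtrace_mulC -!mulmxA [RHS]mxtrace_mulC -!mulmxA.
by rewrite -ker_proj mulmxBr linearB /= im_proj trQ trE subrK.
Qed.

End SubspaceTrace.

(** Coordinates by [in_submod] followed by [val_submod] form a projector onto the row space of
    [U]. *)
Lemma cfRepr_submod (gT : finGroupType) (G : {group gT}) n (rG : mx_representation algC G n)
    (U : 'M_n) (modU : mxmodule rG U) g : g \in G ->
  cfRepr (submod_repr modU) g = sub_trace U (rG g).
Proof.
move=> Gg; rewrite cfunE Gg mulr1n /= /submod_mx.
rewrite in_submodE mxtrace_mulC mulmxA mxtrace_mulC; apply: sub_traceE.
- exact: (mxmoduleP modU).
- by rewrite -val_submodE val_submodP.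
by rewrite mulmxA -in_submodE -val_submodE in_submodK.
Qed.

(** * The permutation representation on sets of vertices *)

Section FaceRepresentation.

Variables (V : finType) (d : nat) (Phi : balancedRelComplex V d).
Variables (gT : finGroupType) (G : {group gT}) (act : complexAction Phi G).
Implicit Types (tau : {set V}) (g h : gT) (c : {set V} -> algC) (Q : {set {set V}}).

Local Notation n := #|{: {set V}}|.
Local Notation col := (colorn Phi).

Definition set_act g tau : {set V} := [set act v g | v in tau].

Lemma set_act1 tau : set_act 1 tau = tau.
Proof. by rewrite /set_act (eq_imset _ (act1 act)) imset_id. Qed.

Lemma set_actM g h tau : g \in G -> h \in G -> set_act (g * h) tau = set_act h (set_act g tau).
Proof. exact: act_imset_comp. Qed.

Lemma set_actK g : g \in G -> cancel (set_act g) (set_act g^-1).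
Proof. by move=> Gg tau; rewrite -set_actM ?groupV // mulgV set_act1. Qed.

Lemma set_actKV g : g \in G -> cancel (set_act g^-1) (set_act g).
Proof. by move=> Gg tau; rewrite -set_actM ?groupV // mulVg set_act1. Qed.

Lemma set_actU1 g v tau : set_act g (v |: tau) = act v g |: set_act g tau.
Proof. exact: imsetU1. Qed.

Lemma mem_set_act g v tau : (act v g \in set_act g tau) = (v \in tau).
Proof. exact: mem_imset (act_inj act g). Qed.

(** The action preserves colors, hence positions in the color order; this is why the boundary
    commutes with the action without orientation signs. *)
Lemma pos_set_act g tau v : g \in G -> pos col (set_act g tau) (act v g) = pos col tau v.
Proof.
move=> Gg; rewrite /pos -[RHS](card_imset _ (act_inj act g)); apply: eq_card => w.
apply/setIdP/imsetP => [[/imsetP[u ut ->]]|[u]].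
  by rewrite /colorn !act_color // => lt; exists u; rewrite // inE ut.
by rewrite inE => /andP[ut lt] ->; rewrite mem_set_act ut /colorn !act_color.
Qed.

Definition face_mx g : 'M[algC]_n :=
  \matrix_(i, j) (enum_val j == set_act g (enum_val i))%:R.

Lemma row_of_face_mx c g : g \in G ->
  row_of c *m face_mx g = row_of (fun tau => c (set_act g^-1 tau)).
Proof.
move=> Gg; apply/rowP => j; rewrite !mxE (bigD1 (enum_rank (set_act g^-1 (enum_val j)))) //=.
rewrite !mxE enum_rankK set_actKV // eqxx mulr1 big1 ?addr0 // => i ne.
rewrite !mxE; case: eqP => [e|_]; last by rewrite mulr0.
by case/eqP: ne; rewrite e set_actK // enum_valK.
Qed.

Lemma eq_mx_row_of m (A B : 'M[algC]_(n, m)) :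
  (forall c, row_of c *m A = row_of c *m B) -> A = B.
Proof. by move=> eqAB; apply/row_matrixP => i; rewrite !rowE -[delta_mx _ _]fun_ofK. Qed.

Lemma face_mx_repr : mx_repr G face_mx.
Proof.
split=> [|g h Gg Gh]; apply: eq_mx_row_of => c.
  rewrite row_of_face_mx ?group1 // mulmx1; apply: eq_row_of => tau.
  by rewrite invg1 set_act1.
rewrite mulmxA !row_of_face_mx ?groupM //; apply: eq_row_of => tau.
by rewrite invMg set_actM ?groupV.
Qed.

Definition face_repr := MxRepresentation face_mx_repr.

Definition stable Q := forall g tau, g \in G -> tau \in Q -> set_act g tau \in Q.

Lemma stableE Q g tau : stable Q -> g \in G -> (set_act g tau \in Q) = (tau \in Q).
Proof.
move=> stQ Gg; apply/idP/idP; last exact: stQ.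
by move/(stQ g^-1%g); rewrite groupV set_actK //; apply.
Qed.

Lemma ind_mx_face_mx Q g : stable Q -> g \in G ->
  ind_mx algC Q *m face_mx g = face_mx g *m ind_mx algC Q.
Proof.
move=> stQ Gg; apply: eq_mx_row_of => c; rewrite !mulmxA row_of_ind !row_of_face_mx // row_of_ind.
by apply: eq_row_of => tau; rewrite stableE ?groupV.
Qed.

Lemma bd_mx_face_mx Q g : stable Q -> g \in G ->
  bd_mx col algC Q *m face_mx g = face_mx g *m bd_mx col algC Q.
Proof.
move=> stQ Gg; apply: eq_mx_row_of => c; rewrite !mulmxA row_of_bd !row_of_face_mx // row_of_bd.
apply: eq_row_of => tau; rewrite -[tau in RHS](set_actKV Gg).
move: (set_act _ tau) => {}tau; rewrite /bd stableE //; case: ifP => // _.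
rewrite [RHS](reindex_inj (act_inj act g)) /=; apply: eq_big => v; first by rewrite mem_set_act.
by move=> vt; rewrite -set_actU1 pos_set_act // set_actK.
Qed.

Lemma trace_face_ind Q g :
  \tr (face_mx g *m ind_mx algC Q) = #|[set tau in Q | set_act g tau == tau]|%:R.
Proof.
rewrite -sum1dep_card natr_sum big_mkcond /= [RHS](reindex (@enum_val _ {: {set V}})) /=; last first.
  by exists enum_rank => i _; rewrite ?enum_valK ?enum_rankK.
apply: eq_bigr => i _; rewrite mxE (bigD1 i) //= big1 => [|k ne]; last first.
  by rewrite [ind_mx _ _ _ _]mxE (negPf ne) mulr0.
by rewrite addr0 !mxE eqxx eq_sym andbC; case: eqP => _; case: (_ \in _); rewrite ?mulr1 ?mulr0.
Qed.

(** * The Hopf trace formula and the character of the top cycles *)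

Section AlternatingSum.

Variables (P : {set {set V}}) (t : nat).
Hypotheses (cP : convex P) (oP : orderable col P) (stP : stable P).
Hypothesis exP : forall k, (k < t)%N -> exact_at col algC P k.

Let D := bd_mx col algC P.
Let Z k := (ind_mx algC (level P k) :&: kermx D)%MS.

Lemma level_stable k : stable (level P k).
Proof.
move=> g tau Gg; rewrite !inE => /andP[Pt tk]; rewrite stP //.
by rewrite card_imset //; apply: act_inj.
Qed.

Lemma ind_mx_module k : mxmodule face_repr (ind_mx algC (level P k)).
Proof.
by apply/mxmoduleP => g Gg; rewrite /= ind_mx_face_mx ?submxMl //; apply: level_stable.
Qed.

Lemma cycle_mx_module k : mxmodule face_repr (Z k).
Proof.
apply: capmx_module (ind_mx_module k) _; apply/mxmoduleP => g Gg; apply/sub_kermxP.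
by rewrite -mulmxA /= -bd_mx_face_mx // mulmxA mulmx_ker mul0mx.
Qed.

Lemma sub_trace_ind_mx k g : g \in G ->
  sub_trace (ind_mx algC (level P k)) (face_mx g) = #|[set tau in level P k | set_act g tau == tau]|%:R.
Proof.
move=> Gg; rewrite -trace_face_ind; symmetry; apply: sub_traceE => //; last exact: ind_mx_id.
exact: (mxmoduleP (ind_mx_module k)).
Qed.

Lemma bd_mx_level0 : ind_mx algC (level P 0) *m D = 0.
Proof.
apply: eq_mx_row_of => c; rewrite mulmxA row_of_ind row_of_bd mulmx0.
apply/rowP => i; rewrite !mxE /bd; case: ifP => // _; apply: big1 => v vt.
by rewrite inE cardsU1 vt andbF mulr0.
Qed.

(* Hopf trace formula for a complex that is exact except in its top degree [t]. *)
Lemma sub_trace_cycles k g : g \in G -> (k <= t)%N ->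
  sub_trace (Z k) (face_mx g) =
    \sum_(j < k.+1) (-1) ^+ (k - j) * #|[set tau in level P j | set_act g tau == tau]|%:R.
Proof.
move=> Gg; have step j : sub_trace (ind_mx algC (level P j)) (face_mx g) =
    sub_trace (Z j) (face_mx g) + sub_trace (ind_mx algC (level P j) *m D) (face_mx g).
  by apply: sub_trace_ker_im; [exact: (mxmoduleP (ind_mx_module j)) | exact: bd_mx_face_mx].
elim: k => [_|k IHk lt_kt].
  (* Exactness at [k] identifies the boundaries from level [k.+1] with the cycles [Z k], to which
     the induction hypothesis applies. *)
  have := step 0; rewrite bd_mx_level0 /sub_trace !mulmx0 mxtrace0 addr0 -/(sub_trace _ _) -/(sub_trace _ _).
  by move <-; rewrite big_ord1 subn0 mul1r sub_trace_ind_mx.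
have := step k.+1; rewrite -(@eq_sub_trace _ _ (Z k) (ind_mx algC (level P k.+1) *m D)); last 2 first.
- exact: (mxmoduleP (cycle_mx_module k)).
- by apply/andP; split; [apply/exact_mxP/exP | apply: ind_mx_ker_bd].
rewrite IHk ?(ltnW lt_kt) // sub_trace_ind_mx // => /eqP; rewrite -subr_eq => /eqP <-.
rewrite [RHS]big_ord_recr /= subnn mul1r addrC; congr (_ + _).
rewrite -sumrN; apply: eq_bigr => j _.
by rewrite subSn ?leq_ord // exprS mulN1r mulNr.
Qed.

Lemma effective_alternating_sum (chi : 'CF(G)) :
  (forall g, g \in G -> chi g =
    \sum_(j < t.+1) (-1) ^+ (t - j) * #|[set tau in level P j | set_act g tau == tau]|%:R) ->
  chi \is a character.
Proof.
move=> chiE; suff -> : chi = cfRepr (submod_repr (cycle_mx_module t)) by apply: cfRepr_char.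
apply/cfunP => g; have [Gg|nGg] := boolP (g \in G); last by rewrite !cfun0.
by rewrite cfRepr_submod //= chiE // sub_trace_cycles.
Qed.

End AlternatingSum.

End FaceRepresentation.

(** * Alternating sums of flag vectors and the conclusion *)

Lemma sum_sign_interval (K : numDomainType) (I : finType) (X Y : {set I}) : X \subset Y ->
  \sum_(R : {set I} | (X \subset R) && (R \subset Y)) (-1) ^+ #|R| =
    if X == Y then (-1) ^+ #|Y| else 0 :> K.
Proof.
move=> sXY; have [->|neXY] := eqVneq X Y.
  by apply: big_pred1 => R; rewrite [RHS]eq_sym eqEsubset.
have /subsetPn[c Yc Xc] : ~~ (Y \subset X) by apply: contra neXY => sYX; rewrite eqEsubset sXY.
(* Sign-reversing involution: inserting or removing an element [c] of [Y] outside [X] keeps [R] in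
   the interval. *)
pose toggle (R : {set I}) := if c \in R then R :\ c else c |: R.
have toggleK : involutive toggle.
  move=> R; rewrite /toggle; have [cR|cR] := boolP (c \in R); first by rewrite setD11 setD1K.
  by rewrite setU11 setU1K.
set s := \sum_(R | _) _; suff: s = - s.
  by move/eqP; rewrite -addr_eq0 -mulr2n mulrn_eq0 => /orP[//|/eqP].
rewrite {1}/s (reindex_inj (inv_inj toggleK)) -sumrN /toggle; apply: eq_big => R.
  case: ifP => cR; rewrite ?subsetD1 ?Xc ?andbT ?subUset ?sub1set ?Yc /=.
    congr (_ && _); apply/idP/idP => [sRY|]; last exact/subset_trans/subsetDl.
    by rewrite -(setD1K cR) subUset sub1set Yc.
  by rewrite -subDset (setDidPl _) // disjoints_subset subsetC sub1set inE.
case: ifP => cR _; last by rewrite cardsU1 cR exprS mulN1r.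
by rewrite [in RHS](cardsD1 c R) cR exprS mulN1r opprK.
Qed.

(** For fixed [Q], the signs are summed over the [R] between [S :|: Q] and [T]; they cancel unless
    [S :|: Q = T], that is, unless [Q] contains [T :\: S]. *)
Lemma sum_flag_h (V : finType) (d : nat) (Phi : balancedRelComplex V d)
    (gT : finGroupType) (G : {group gT}) (act : complexAction Phi G) (S T : {set 'I_d}) :
  S \subset T ->
  \sum_(R : {set 'I_d} | (S \subset R) && (R \subset T)) flag_h act R =
    \sum_(Q : {set 'I_d} | (T :\: S \subset Q) && (Q \subset T)) (-1) ^+ #|T :\: Q| *: flag_f act Q.
Proof.
move=> sST; rewrite /flag_h (exchange_big_dep xpredT) //= [RHS]big_mkcond; apply: eq_bigr => Q _.
rewrite -scaler_suml; have [sQT|nQT] := boolP (Q \subset T); last first.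
  rewrite andbF big_pred0 ?scale0r // => R; apply: contraNF nQT => /andP[/andP[_ sRT] sQR].
  exact: subset_trans sRT.
rewrite andbT; have -> : (T :\: S \subset Q) = (S :|: Q == T).
  by rewrite subDset eqEsubset subUset sST sQT.
have cardsign (R : {set 'I_d}) : Q \subset R -> (-1) ^+ #|R :\: Q| = (-1) ^+ #|Q| * (-1) ^+ #|R| :> algC.
  move=> sQR; rewrite -(cardsID Q R) (setIidPr sQR) exprD signrMK //.
have -> : \sum_(R : {set 'I_d} | (S \subset R) && (R \subset T) && (Q \subset R)) (-1) ^+ #|R :\: Q| =
    (-1) ^+ #|Q| * \sum_(R : {set 'I_d} | (S :|: Q \subset R) && (R \subset T)) (-1) ^+ #|R| :> algC.
  rewrite mulr_sumr; apply: eq_big => [R|R /andP[_ /cardsign //]].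
  by rewrite subUset andbAC.
rewrite sum_sign_interval ?subUset ?sST ?sQT //.
by case: eqP => _; rewrite ?mulr0 ?scale0r // -cardsign.
Qed.

Lemma effective_sum_flag_h (F : fieldType) (V : finType) (d : nat)
    (Phi : balancedRelComplex V d) (gT : finGroupType) (G : {group gT})
    (act : complexAction Phi G) (l : nat) (S T : {set 'I_d}) :
  serre_condition F Phi l -> S \subset T -> (#|S| <= l)%N ->
  \sum_(R : {set 'I_d} | (S \subset R) && (R \subset T)) flag_h act R \is a character.
Proof.
move=> serre sST leSl; rewrite sum_flag_h //; pose P := color_interval Phi (T :\: S) T.
have stP : stable act P.
  move=> g tau Gg /color_intervalP[Pt At tB]; have eq_col : color Phi @: set_act act g tau = color Phi @: tau.
    by rewrite -imset_comp; apply: eq_imset => v /=; rewrite act_color.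
  by apply/color_intervalP; rewrite eq_col; split=> //; apply: act_faces.
(* From [#|S| <= l] follows [#|T| <= #|T :\: S| + l], so every [k] below the top degree is in the
   range of exactness. *)
have exP k : (k < #|T|)%N -> exact_at (colorn Phi) algC P k.
  move=> kT; apply: (exact_color_interval (l := l)) => //; first exact: subsetDl.
    by apply: leq_trans kT _; rewrite -(cardsID S T) addnC leq_add2l (setIidPr sST).
  by move=> *; apply: (serre_exact_star serre); eassumption.
apply: (effective_alternating_sum (@color_interval_convex _ _ _ _ _)
  (@color_interval_orderable _ _ _ _ _) stP exP) => g Gg.
have card_col tau : tau \in Phi -> #|color Phi @: tau| = #|tau|.
  by move=> Pt; apply: card_in_imset; apply: faces_balanced Pt.
pose fixP := [set tau in P | set_act act g tau == tau].
(* Both sides are signed counts of fixed faces, grouped by color set on the left and by cardinality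
   on the right; a face has as many colors as vertices. *)
transitivity (\sum_(tau in fixP) (-1) ^+ (#|T| - #|tau|) : algC).
  rewrite sum_cfunE (partition_big (fun tau : {set V} => color Phi @: tau)
    (fun Q => (T :\: S \subset Q) && (Q \subset T))) /=; last first.
    by move=> tau /setIdP[/color_intervalP[_ -> ->]].
  apply: eq_bigr => Q /andP[AQ QT]; rewrite !cfunE Gg.
  rewrite cardsD (setIidPr QT) -[#|fixed_faces _ _ _|]sum1_card natr_sum mulr_sumr.
  apply: eq_big => [tau|tau].
    rewrite !inE -andbA; case: (tau \in Phi) => //=.
    by case: (_ =P Q) => [->|_]; rewrite ?AQ ?QT ?andbT ?andbF.
  by rewrite !inE => /andP[/andP[Pt /eqP <-] _]; rewrite mulr1 card_col.
rewrite (partition_big (fun tau : {set V} => inord #|tau| : 'I_#|T|.+1) xpredT) //=.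
apply: eq_bigr => j _; rewrite -[#|[set tau in level _ _ | _]|]sum1_card natr_sum mulr_sumr.
have inordE tau : tau \in P -> (inord #|tau| == j) = (#|tau| == j).
  move=> /color_intervalP[Pt _ tT]; rewrite -val_eqE /= inordK // ltnS -card_col //.
  exact: subset_leq_card.
apply: eq_big => [tau|tau /andP[/setIdP[Ft _]]].
  apply/andP/setIdP => [[/setIdP[Ft fix_t]]|[/levelP[Ft tj] fix_t]].
    by rewrite inordE // => tj; split=> //; apply/setIdP.
  by rewrite inordE // tj; split=> //; apply/setIdP.
by rewrite inordE // => /eqP->; rewrite mulr1.
Qed.

Theorem theorem1p3 (F : fieldType) (V : finType) (d : nat)
    (Phi : balancedRelComplex V d) (gT : finGroupType) (G : {group gT})
    (act : complexAction Phi G) :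
  (forall l : nat, serre_condition F Phi l ->
     forall S T : {set 'I_d}, S \subset T -> (#|S| <= l)%N ->
       effective (\sum_(R : {set 'I_d} | (S \subset R) && (R \subset T)) flag_h act R))
  /\
  (relatively_CM F Phi ->
     forall T : {set 'I_d}, effective (flag_h act T)).
Proof.
split=> [l serre S T sST leSl|CM T]; first exact: effective_sum_flag_h serre sST leSl.
(* With [S = T] the interval contains [T] alone, and [#|T| <= d] always holds. *)
have := effective_sum_flag_h act CM (subxx T).
rewrite (big_pred1 T) => [|R]; last by rewrite /= eqEsubset andbC.
by apply; rewrite -[leqRHS](card_ord d) max_card.
Qed.
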